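(* Let $T$ be an $n\times n$ matrix. Then $T$ is irreducible if and only if the operator $L_T+R_T$ on $M_n(\mathbb C)$ is irreducible.
   Context: $M_n(\mathbb C)$ is the algebra of $n\times n$ complex matrices with the entrywise order (a matrix is positive if all its entries are real and $\ge0$), viewed also as the coordinate Banach lattice $\mathbb C^{n\times n}$. $L_TS=TS$ and $R_TS=ST$ for $S\in M_n(\mathbb C)$. Irreducibility is a notion for positive elements, so ''irreducible'' includes being positive: a matrix (on $\mathbb C^n$), or an operator on the lattice $M_n(\mathbb C)$, is irreducible if it is positive (maps positive elements to positive elements) and leaves no band invariant other than $\{0\}$ and the whole space, where bands are the subspaces of vectors supported on a given subset of the coordinates (for $M_n(\mathbb C)$: matrices supported on a given subset of the entries). The zero $1\times1$ matrix is irreducible. *)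

(* Defs.v *)
From HB Require Import structures.
From mathcomp Require Import all_boot all_order all_algebra.
From mathcomp Require Import classical_sets reals complex.

Set Implicit Arguments.
Unset Strict Implicit.
Unset Printing Implicit Defensive.

Import Order.TTheory GRing.Theory Num.Theory.

Local Open Scope classical_set_scope.
Local Open Scope ring_scope.
Local Open Scope complex_scope.

(* The lattice 'M[R[i]]_(m, k) has coordinate set 'I_m * 'I_k; the lattice of
   column vectors C^n is the instance 'cV_n = 'M_(n, 1). *)

(* In R[i], 0 <= z holds iff z is real and nonnegative. *)
Definition positive_mx (R : realType) (m k : nat) (S : 'M[R[i]]_(m, k)) : Prop :=
  forall (i : 'I_m) (j : 'I_k), 0 <= S i j.

Definition positive_op (R : realType) (m k : nat)
    (f : {linear 'M[R[i]]_(m, k) -> 'M[R[i]]_(m, k)}) : Prop :=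
  forall S : 'M[R[i]]_(m, k), positive_mx S -> positive_mx (f S).

Definition band (R : realType) (m k : nat) (A : {set 'I_m * 'I_k}) :
    set 'M[R[i]]_(m, k) :=
  [set S | forall (i : 'I_m) (j : 'I_k), (i, j) \notin A -> S i j = 0].
Arguments band R {m k} A.

Definition irreducible_op (R : realType) (m k : nat)
    (f : {linear 'M[R[i]]_(m, k) -> 'M[R[i]]_(m, k)}) : Prop :=
  positive_op f /\
  forall A : {set 'I_m * 'I_k},
    f @` band R A `<=` band R A -> band R A = [set 0] \/ band R A = setT.

Definition matrix_op (R : realType) (n : nat) (T : 'M[R[i]]_n) :
    {linear 'cV[R[i]]_n -> 'cV[R[i]]_n} := mulmx T.

Definition irreducible_mx (R : realType) (n : nat) (T : 'M[R[i]]_n) : Prop :=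
  irreducible_op (matrix_op T).

Definition left_mul (R : realType) (n : nat) (T : 'M[R[i]]_n) :
    {linear 'M[R[i]]_n -> 'M[R[i]]_n} := mulmx T.

Definition right_mul (R : realType) (n : nat) (T : 'M[R[i]]_n) :
    {linear 'M[R[i]]_n -> 'M[R[i]]_n} := mulmxr T.

(* Main.v *)
Require Import Defs.
From mathcomp Require Import all_boot all_order all_algebra.
From mathcomp Require Import classical_sets reals complex.

Local Open Scope ring_scope.
Local Open Scope complex_scope.

(** A band is invariant under a linear operator exactly when its coordinate set
    is closed under the directed graph that joins [p] to [q] when the image of
    the matrix unit [E_p] has a nonzero entry at [q].  Irreducibility is thus
    positivity together with the absence of proper nonempty closed sets
    ([irreducible_opP]), and the theorem compares two graphs.

    The graph of [T] joins [k] to [i] when [T i k != 0].  Since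
    [T E_(k,l) + E_(k,l) T] has entry
    [T i k * (l == j) + (k == i) * T l j] at [(i, j)], the graph of [L_T + R_T]
    has two kinds of moves: along the graph of [T] in the first index, and
    against it in the second.  For [T >= 0] the two summands cannot cancel, so
    all these moves are present.

    If [T] is irreducible and a closed set [A] of pairs contains [(k, l)], the
    section of [A] at second index [l] is closed for [T], hence full; each
    section at a fixed first index then contains [l], and its complement is
    closed for [T], hence empty.  So [A] is everything.

    Conversely, if [B] is closed for [T], then [B * 'I_n] is closed for
    [L_T + R_T], so [B] is trivial.  Positivity of [T] is read off from the
    entries at [(i, k)] of the images of the diagonal units [E_(k,k)]: they are
    [T i k] for [i != k] and [2 T k k] for [i = k]. *)

Import Order.TTheory GRing.Theory Num.Theory.
Import boot.finset.

(** * Bands and closed coordinate sets *)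

Definition coord_closed (R : realType) (m k : nat)
    (f : {linear 'M[R[i]]_(m, k) -> 'M[R[i]]_(m, k)})
    (A : {set 'I_m * 'I_k}) : Prop :=
  forall p q, p \in A -> f (delta_mx p.1 p.2) q.1 q.2 != 0 -> q \in A.

Section Bands.

Variables (R : realType) (m k : nat).
Implicit Types (A : {set 'I_m * 'I_k}).
Implicit Types (f : {linear 'M[R[i]]_(m, k) -> 'M[R[i]]_(m, k)}).

Lemma delta_mx_band A (p : 'I_m * 'I_k) :
  p \in A -> band R A (delta_mx p.1 p.2).
Proof.
move=> pA i j; rewrite mxE; case: eqP => [->|//]; case: eqP => [->|//] /=.
by rewrite -surjective_pairing pA.
Qed.

Lemma linear_mx_entry f (S : 'M[R[i]]_(m, k)) i j :
  f S i j = \sum_a \sum_b S a b * f (delta_mx a b) i j.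
Proof.
rewrite {1}[S]matrix_sum_delta linear_sum summxE; apply: eq_bigr => a _.
by rewrite linear_sum summxE; apply: eq_bigr => b _; rewrite linearZ mxE.
Qed.

(** Matrix units of [A] lie in the band, which makes closedness necessary; an
    entry of [f S] is a combination of the entries of the images of the units
    ([linear_mx_entry]), which makes it sufficient. *)
Lemma band_invariantP f A :
  (f @` band R A `<=` band R A)%classic <-> coord_closed R m k f A.
Proof.
split=> [inv p [i j] pA fpq|clA _ [S SA <-] i j ijA].
  apply: contraNT fpq => ijA; apply/eqP; apply: (inv _ _ i j ijA).
  by exists (delta_mx p.1 p.2) => //; apply: delta_mx_band.
rewrite linear_mx_entry big1 // => a _; rewrite big1 // => b _.
have [abA|abA] := boolP ((a, b) \in A); last by rewrite SA ?mul0r.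
have [->|nz] := eqVneq (f (delta_mx a b) i j) 0; first by rewrite mulr0.
by move: ijA; rewrite (clA (a, b) (i, j) abA nz).
Qed.

Lemma band_eq0P A : band R A = [set 0]%classic <-> A = set0.
Proof.
split=> [A0|->].
  apply/setP => p; rewrite inE; apply/negP => /delta_mx_band.
  rewrite A0 => /matrixP/(_ p.1 p.2)/eqP.
  by rewrite !mxE !eqxx oner_eq0.
apply/seteqP; split=> S /=; last by move=> -> i j _; rewrite mxE.
by move=> S0; apply/matrixP => i j; rewrite mxE S0 ?inE.
Qed.

Lemma band_eqTP A : band R A = classical_sets.setT <-> A = setT.
Proof.
split=> [AT|->].
  apply/setP => -[i j]; rewrite inE; apply/negPn/negP => ijA.
  have : band R A (const_mx 1) by rewrite AT.
  by move=> /(_ i j ijA)/eqP; rewrite mxE oner_eq0.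
by apply/seteqP; split=> // S _ i j; rewrite inE.
Qed.

Lemma positive_opP f :
  positive_op f <-> forall a b, positive_mx (f (delta_mx a b)).
Proof.
split=> [fpos a b|fpos S S0 i j].
  by apply: fpos => i j; rewrite mxE ler0n.
rewrite linear_mx_entry; apply: sumr_ge0 => a _; apply: sumr_ge0 => b _.
by apply: mulr_ge0; [apply: S0|apply: fpos].
Qed.

Lemma irreducible_opP f :
  irreducible_op f <->
  (forall a b, positive_mx (f (delta_mx a b))) /\
  (forall A, coord_closed R m k f A -> A = set0 \/ A = setT).
Proof.
split=> -[/positive_opP fpos irr]; split=> // A /band_invariantP /irr.
  by case=> [/band_eq0P|/band_eqTP]; [left|right].
by case=> [/band_eq0P|/band_eqTP]; [left|right].
Qed.

End Bands.

(** * The graphs of [T] and of [L_T + R_T] *)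

Section Graphs.

Variables (R : realType) (n : nat) (T : 'M[R[i]]_n).

Lemma mulmx_delta (p : nat) (k : 'I_n) (l : 'I_p) i j :
  (T *m delta_mx k l) i j = T i k *+ (l == j).
Proof.
rewrite mxE (bigD1 k) //= big1 ?addr0 => [|a /negPf ak].
  by rewrite mxE eqxx eq_sym mulr_natr.
by rewrite mxE ak mulr0.
Qed.

Lemma delta_mulmx (k l i j : 'I_n) :
  (delta_mx k l *m T) i j = T l j *+ (k == i).
Proof.
rewrite mxE (bigD1 l) //= big1 ?addr0 => [|a /negPf al].
  by rewrite mxE eqxx andbT eq_sym mulr_natl.
by rewrite mxE al andbF mul0r.
Qed.

Lemma left_right_mul_delta (k l i j : 'I_n) :
  (left_mul T \+ right_mul T) (delta_mx k l) i j =
  T i k *+ (l == j) + T l j *+ (k == i).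
Proof. by rewrite mxE mulmx_delta delta_mulmx. Qed.

(** [irreducible_opP] for [matrix_op T], whose coordinates ['I_n * 'I_1] are
    those of column vectors, reindexed by ['I_n] so that sections of a subset of
    ['I_n * 'I_n] can be fed to it. *)
Lemma irreducible_mxP :
  irreducible_mx T <->
  positive_mx T /\
  (forall B : {set 'I_n},
     (forall k i, k \in B -> T i k != 0 -> i \in B) -> B = set0 \/ B = setT).
Proof.
split=> [/irreducible_opP[Tpos irr]|[Tpos irr]].
  split=> [i k|B clB].
    by have := Tpos k ord0 i ord0; rewrite mulmx_delta eqxx.
  have [|B0|BT] := irr [set p | p.1 \in B].
  - move=> [k z] [i w]; rewrite !inE /= mulmx_delta !ord1 eqxx; exact: clB.
  - left; apply/setP => i.
    by have /setP/(_ (i, ord0)) := B0; rewrite !inE.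
  - right; apply/setP => i.
    by have /setP/(_ (i, ord0)) := BT; rewrite !inE.
apply/irreducible_opP; split=> [k z i w|A clA].
  by rewrite mulmx_delta mulrn_wge0.
have [|B0|BT] := irr [set i | (i, ord0) \in A].
- move=> k i; rewrite !inE => kA Tik; apply: (clA _ (i, ord0) kA).
  by rewrite mulmx_delta eqxx.
- left; apply/setP => -[i w]; rewrite ord1.
  by have /setP/(_ i) := B0; rewrite !inE.
- right; apply/setP => -[i w]; rewrite ord1.
  by have /setP/(_ i) := BT; rewrite !inE.
Qed.

Lemma left_right_mul_positiveP :
  (forall k l, positive_mx ((left_mul T \+ right_mul T) (delta_mx k l))) <->
  positive_mx T.
Proof.
split=> [pos i k|Tpos k l i j].
  have := pos k k i k; rewrite left_right_mul_delta eqxx.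
  by have [->|_] := eqVneq k i; rewrite ?addr0 // -mulr2n pmulrn_lge0.
by rewrite left_right_mul_delta addr_ge0 ?mulrn_wge0.
Qed.

(** Positivity of [T] excludes cancellation between the two summands of
    [left_right_mul_delta], so a nonzero entry of [T] gives a move in either
    index. *)
Lemma coord_closed_moves (A : {set 'I_n * 'I_n}) :
  positive_mx T -> coord_closed R n n (left_mul T \+ right_mul T) A ->
  (forall k i l, (k, l) \in A -> T i k != 0 -> (i, l) \in A) /\
  (forall k l j, (k, l) \in A -> T l j != 0 -> (k, j) \in A).
Proof.
move=> Tpos clA; split=> [k i l|k l j] klA /negPf nz; apply: (clA _ (_, _) klA);
  by rewrite left_right_mul_delta eqxx paddr_eq0 ?mulrn_wge0 //= nz ?andbF.
Qed.

End Graphs.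

Theorem theorem33 (R : realType) (n : nat) (T : 'M[R[i]]_n) :
  irreducible_mx T <-> irreducible_op (left_mul T \+ right_mul T).
Proof.
split=> [/irreducible_mxP[Tpos irr]|].
  apply/irreducible_opP; split; first exact/left_right_mul_positiveP.
  move=> A /(coord_closed_moves _ _ _ _ Tpos)[moveL moveR].
  have [->|[[k l] klA]] := set_0Vmem A; [by left|right].
  have colT i : (i, l) \in A.
    have [|B0|BT] := irr [set a | (a, l) \in A].
    - by move=> a b; rewrite !inE; apply: moveL.
    - by have /setP/(_ k) := B0; rewrite !inE klA.
    - by have /setP/(_ i) := BT; rewrite !inE.
  apply/setP => -[i j]; rewrite inE.
  (* Moves in the second index run against the graph of T, so it is the
     complement of the section that is closed. *)
  have [|C0|CT] := irr [set b | (i, b) \notin A].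
  - move=> a b; rewrite !inE => iaA Tba; apply: contra iaA => ibA.
    exact: moveR ibA Tba.
  - by have /setP/(_ j) := C0; rewrite !inE => /negbFE.
  - by have /setP/(_ l) := CT; rewrite !inE colT.
move=> /irreducible_opP[/left_right_mul_positiveP Tpos irr].
apply/irreducible_mxP; split=> // B clB.
have [|B0|BT] := irr [set p | p.1 \in B].
- move=> [k l] [i j]; rewrite !inE left_right_mul_delta /= => kB.
  have [<- //|_] := eqVneq k i; rewrite addr0.
  by case: (l == j); rewrite ?eqxx //; apply: clB.
- left; apply/setP => i.
  by have /setP/(_ (i, i)) := B0; rewrite !inE.
- right; apply/setP => i.
  by have /setP/(_ (i, i)) := BT; rewrite !inE.
Qed.
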